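(* Let $A$ be an affine semigroup and let $k$ be a field of prime characteristic $p>0$. Let $N_0\in\mathbb{N}$ be minimal such that $p^{N_0}\mathbf{v}\in A$ for all $\mathbf{v}\in{}^{*p}A$ (such an integer exists). Then for any ideal $I\subset k[A]$, the Frobenius test exponent of $I$ satisfies $\operatorname{Fte} I\le N_0$.
   Context: $\mathbb{N}$ contains $0$. An affine semigroup is a finitely generated submonoid $A$ of $\mathbb{N}^n$. $G(A)\subset\mathbb{Z}^n$ is the subgroup generated by $A$, $C(A)$ is the cone of non-negative real combinations of elements of $A$, and $\overline{A}=G(A)\cap C(A)$. For a prime $p$, ${}^{*p}A=\{\mathbf{v}\in\overline{A}\mid p^e\mathbf{v}\in A\text{ for some }e\in\mathbb{N}\}$ is the $p$-weak normalization. The affine semigroup ring $k[A]$ is the $k$-subalgebra of $k[x_1,\dots,x_n]$ spanned by the monomials $\mathbf{x}^{\mathbf{a}}$, $\mathbf{a}\in A$. For an ideal $I$ of a Noetherian ring $R$ of characteristic $p$, $I^{[p^e]}$ is the ideal generated by $\{x^{p^e}\mid x\in I\}$. The Frobenius closure of $I$ is the ideal $I^F=\{x\in R\mid x^{p^e}\in I^{[p^e]}\text{ for some }e\in\mathbb{N}\}$. The Frobenius test exponent $\operatorname{Fte} I$ is the least $e\in\mathbb{N}$ such that $(I^F)^{[p^e]}=I^{[p^e]}$. *)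

(* Defs.v *)
From HB Require Import structures.
From mathcomp Require Import all_boot all_order all_algebra.
From mathcomp Require Import boolp reals.
From mathcomp Require Import mpoly.

Set Implicit Arguments.
Unset Strict Implicit.
Unset Printing Implicit Defensive.

Import Order.TTheory GRing.Theory Num.Theory.
Local Open Scope ring_scope.

Definition is_least (P : nat -> Prop) (m : nat) : Prop :=
  P m /\ forall m', P m' -> (m <= m')%N.

(* [idealr] of ring_quotient only covers decidable proper ideals. *)
Definition is_ideal (R : comNzRingType) (I : R -> Prop) : Prop :=
  [/\ I 0,
      forall x y, I x -> I y -> I (x + y)
    & forall a x, I x -> I (a * x)].

Definition ideal_gen (R : comNzRingType) (S : R -> Prop) (x : R) : Prop :=
  forall J : R -> Prop, is_ideal J -> (forall y, S y -> J y) -> J x.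

Section Frobenius.
Variables (R : comNzRingType) (p : nat).

Definition frob_power (e : nat) (I : R -> Prop) : R -> Prop :=
  ideal_gen (fun y => exists2 x, I x & y = x ^+ (p ^ e)).

Definition frob_closure (I : R -> Prop) (x : R) : Prop :=
  exists e : nat, frob_power e I (x ^+ (p ^ e)).

(* The least exponent is a relation, since a least [e] need not exist a priori. *)
Definition is_Fte (I : R -> Prop) : nat -> Prop :=
  is_least (fun e =>
    forall x, frob_power e (frob_closure I) x <-> frob_power e I x).

End Frobenius.

Definition is_submonoid (n : nat) (S : 'X_{1..n} -> Prop) : Prop :=
  S 0%MM /\ forall a b, S a -> S b -> S (a + b)%MM.

Definition finitely_generated (n : nat) (S : 'X_{1..n} -> Prop) : Prop :=
  exists s : seq 'X_{1..n},
    (forall a, a \in s -> S a) /\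
    forall T : 'X_{1..n} -> Prop, is_submonoid T ->
      (forall a, a \in s -> T a) -> forall a, S a -> T a.

(* The carrier is boolean so that k[A] can be a subtype of the polynomial
   ring; by [affine_semigroup_of] this does not restrict the semigroups. *)
Record affine_semigroup (n : nat) := AffineSemigroup {
  asg_carrier :> {pred 'X_{1..n}};
  asg_submonoid : is_submonoid (fun a => a \in asg_carrier);
  asg_fg : finitely_generated (fun a => a \in asg_carrier)
}.

Lemma affine_semigroup_of (n : nat) (S : 'X_{1..n} -> Prop) :
  is_submonoid S -> finitely_generated S ->
  exists A : affine_semigroup n, forall a, (a \in A) <-> S a.
Proof.
move=> mS fS; pose B : {pred 'X_{1..n}} := fun a => `[< S a >].
have BE : (fun a => is_true (a \in B)) = S.
  by apply/funext => a; apply/propext; split=> /asboolP.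
have mB : is_submonoid (fun a => a \in B) by rewrite BE.
have fB : finitely_generated (fun a => a \in B) by rewrite BE.
by exists (AffineSemigroup mB fB) => a; split=> /asboolP.
Qed.

Definition gen_subgroup (V : zmodType) (S : V -> Prop) (v : V) : Prop :=
  forall H : V -> Prop, H 0 -> (forall x y, H x -> H y -> H (x - y)) ->
    (forall x, S x -> H x) -> H v.

Definition zvec (n : nat) (a : 'X_{1..n}) : 'rV[int]_n := \row_i (a i)%:Z.

Section WeakNormalization.
Variables (R : realType) (n : nat) (A : affine_semigroup n).

Definition in_asg (v : 'rV[int]_n) : Prop := exists2 a, a \in A & v = zvec a.

Definition asg_group : 'rV[int]_n -> Prop := gen_subgroup in_asg.

Definition asg_cone (x : 'rV[R]_n) : Prop :=
  exists (m : nat) (c : 'I_m -> R) (a : 'I_m -> 'X_{1..n}),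
    [/\ forall i, 0 <= c i, forall i, a i \in A
      & x = \sum_(i < m) c i *: map_mx intr (zvec (a i))].

Definition asg_normalization (v : 'rV[int]_n) : Prop :=
  asg_group v /\ asg_cone (map_mx intr v).

Definition weak_normalization (p : nat) (v : 'rV[int]_n) : Prop :=
  asg_normalization v /\ exists e : nat, in_asg (v *+ p ^ e).

Definition sends_weak_normalization_into (p N : nat) : Prop :=
  forall v : 'rV[int]_n, weak_normalization p v -> in_asg (v *+ p ^ N).

End WeakNormalization.

Section SemigroupRing.
Variables (k : fieldType) (n : nat) (A : affine_semigroup n).

Definition asg_poly_pred : {pred {mpoly k[n]}} :=
  fun f => all (mem A) (msupp f).

Lemma asg_poly_predP (f : {mpoly k[n]}) :
  reflect (exists s : seq (k * 'X_{1..n}),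
             (forall u, u \in s -> u.2 \in A) /\
             f = \sum_(u <- s) u.1 *: 'X_[u.2])
          (f \in asg_poly_pred).
Proof.
apply: (iffP allP) => [Af|[s [As ->]] m].
  exists [seq (f@_m, m) | m <- msupp f]; split.
    by move=> _ /mapP[m mf ->]; exact: Af.
  by rewrite big_map {1}[f]mpolyE.
apply: contraLR => mA; rewrite -mcoeff_eq0 raddf_sum big_seq big1 //= => u us.
rewrite mcoeffZ mcoeffX; case: eqP => [um|_]; last by rewrite mulr0.
by move/negP: mA; case; rewrite -um; exact: As.
Qed.

Lemma asg_poly_subalg : subalg_closed asg_poly_pred.
Proof.
have [A0 AD] := asg_submonoid A; split.
- by apply/allP => m; rewrite msupp1 inE => /eqP ->.
- move=> c f g /allP Af /allP Ag; apply/allP => m /msuppD_le.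
  by rewrite mem_cat => /orP[/msuppZ_le/Af|/Ag].
- move=> f g /allP Af /allP Ag; apply/allP => m /msuppM_le /allpairsP.
  by case=> -[a b] /= [/Af aA /Ag bA ->]; exact: AD.
Qed.

HB.instance Definition _ :=
  GRing.isSubalgClosed.Build k {mpoly k[n]} asg_poly_pred asg_poly_subalg.

Record asg_ring := AsgRing {
  asg_val : {mpoly k[n]};
  asg_valP : asg_val \in asg_poly_pred
}.

HB.instance Definition _ := [isSub for asg_val].
HB.instance Definition _ := [Choice of asg_ring by <:].
HB.instance Definition _ := [SubChoice_isSubComNzRing of asg_ring by <:].
HB.instance Definition _ := [SubZmodule_isSubLmodule of asg_ring by <:].
HB.instance Definition _ :=
  [SubNzRing_SubLmodule_isSubLalgebra of asg_ring by <:].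
HB.instance Definition _ := [SubLalgebra_isSubAlgebra of asg_ring by <:].

End SemigroupRing.

(* Main.v *)
(* Let [q0 = p ^ N0].  If [f ^ q] is a combination of [q]-th powers of elements of
   [I], then projecting onto the monomials [x ^ (q b)] with [b] in [G(A)] keeps
   only terms [c x ^ (q b) i ^ q], and such a [b] lies in the [p]-weak
   normalization because [q b] is in [A].  The coefficients [c] can be taken in
   [k ^ q], so extracting [q]-th roots gives [f = sum c' x ^ b i].  Raising this
   to the power [q0] puts [f ^ q0] in [I ^ [q0]], as [q0 b] is in [A]. *)

Require Import Defs.
From HB Require Import structures.
From mathcomp Require Import all_boot all_order all_algebra.
From mathcomp Require Import boolp reals.
From mathcomp Require Import mpoly.

Set Implicit Arguments.
Unset Strict Implicit.
Unset Printing Implicit Defensive.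

Import GRing.Theory Num.Theory.

Lemma exists_least (P : nat -> Prop) (m : nat) :
  P m -> exists e, is_least P e /\ (e <= m)%N.
Proof.
move=> Pm; have exP : exists e, `[< P e >] by exists m; apply/asboolP.
case: (ex_minnP exP) => e /asboolP Pe min_e.
have le_e m' : P m' -> (e <= m')%N by move=> Pm'; apply/min_e/asboolP.
by exists e; split; [split | exact: le_e].
Qed.

(** * Exponent vectors and their embedding in the integer lattice *)

Section Multinomials.
Variable n : nat.
Implicit Types a b c m : 'X_{1..n}.
Local Open Scope ring_scope.

Lemma mulmn_inj q : (0 < q)%N -> injective (fun m => (m *+ q)%MM).
Proof.
move=> q0 a b /mnmP ab; apply/mnmP => i; move: (ab i).
by rewrite !mulmnE => /eqP; rewrite eqn_pmul2r // => /eqP.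
Qed.

Lemma mulmnDl q a b : ((a + b) *+ q = a *+ q + b *+ q)%MM.
Proof. by apply/mnmP => i; rewrite !(mulmnE, mnmDE) mulnDl. Qed.

Lemma mulmnDr a q r : (a *+ (q + r) = a *+ q + a *+ r)%MM.
Proof. by apply/mnmP => i; rewrite !(mulmnE, mnmDE) mulnDr. Qed.

Lemma mulmnA a q r : (a *+ q *+ r = a *+ (q * r))%MM.
Proof. by apply/mnmP => i; rewrite !mulmnE mulnA. Qed.

Lemma lepm_mul2r q a b :
  (0 < q)%N -> (a *+ q <= b *+ q)%MM -> (a <= b)%MM.
Proof.
move=> q0 /mnm_lepP ab; apply/mnm_lepP => i; move: (ab i).
by rewrite !mulmnE leq_pmul2r.
Qed.

Lemma zvecD a b : zvec (a + b)%MM = zvec a + zvec b.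
Proof. by apply/rowP => i; rewrite !mxE mnmDE PoszD. Qed.

Lemma zvec0 : zvec (0%MM : 'X_{1..n}) = 0.
Proof. by apply/rowP => i; rewrite !mxE mnmE. Qed.

Lemma zvecMn a q : zvec (a *+ q)%MM = zvec a *+ q.
Proof.
by apply/rowP => i; rewrite mulmxnE !mxE mulmnE PoszM mulrC -mulr_natl natz.
Qed.

Lemma zvecB a b : (b <= a)%MM -> zvec (a - b)%MM = zvec a - zvec b.
Proof. by move=> ba; rewrite -{2}(submK ba) zvecD addrK. Qed.

Lemma zvec_inj : injective (@zvec n).
Proof.
by move=> a b /rowP ab; apply/mnmP => i; have := ab i; rewrite !mxE => -[].
Qed.

(** Non-negativity passes from [v *+ q] to [v], so elements of the weak normalization are exponents
    of genuine monomials. *)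
Lemma zvec_of_mulrn (v : 'rV[int]_n) a q :
  (0 < q)%N -> v *+ q = zvec a -> exists b, v = zvec b.
Proof.
move=> q0 /rowP va; exists [multinom `|v 0%R i|%N | i < n].
apply/rowP => i; rewrite mxE mnmE gez0_abs //.
have := va i; rewrite mulmxnE mxE => vi.
by rewrite -(pmulrn_lge0 _ q0) vi.
Qed.

End Multinomials.

(** * The weak normalization and a uniform exponent for it *)

Section Semigroup.
Variables (n : nat) (A : affine_semigroup n).
Implicit Types a b c m : 'X_{1..n}.
Local Open Scope ring_scope.

Lemma asg0 : 0%MM \in A.
Proof. by case: (asg_submonoid A). Qed.

Lemma asgD a b : a \in A -> b \in A -> (a + b)%MM \in A.
Proof. by case: (asg_submonoid A) => _; apply. Qed.

Lemma asg_sum (I : Type) (r : seq I) (F : I -> 'X_{1..n}) :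
  (forall i, F i \in A) -> (\sum_(i <- r) F i)%MM \in A.
Proof.
by move=> AF; elim/big_rec: _ => [|i x _ Ax]; [exact: asg0 | exact/asgD].
Qed.

Lemma asgMn a q : a \in A -> (a *+ q)%MM \in A.
Proof.
by move=> Aa; elim: q => [|q IHq]; rewrite ?mulm0n ?asg0 // mulmS asgD.
Qed.

Lemma asg_groupP a : a \in A -> asg_group A (zvec a).
Proof. by move=> Aa H _ _; apply; exists a. Qed.

Lemma asg_groupB x y : asg_group A x -> asg_group A y -> asg_group A (x - y).
Proof.
by move=> Gx Gy H H0 HB HA; exact: (HB _ _ (Gx H H0 HB HA) (Gy H H0 HB HA)).
Qed.

Lemma asg_groupD x y : asg_group A x -> asg_group A y -> asg_group A (x + y).
Proof.
move=> Gx Gy; rewrite -[y]opprK; apply: asg_groupB => //.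
by rewrite -[- y]add0r; apply: asg_groupB => // H.
Qed.

(* The cone condition of [weak_normalization] is omitted: it follows from
   [b *+ p ^ e] being in [A]. *)
Definition weak_mnm (p : nat) (b : 'X_{1..n}) : Prop :=
  asg_group A (zvec b) /\ exists e, (b *+ p ^ e)%MM \in A.

Lemma sends_weak_normalization_intoP (R : realType) (p N : nat) :
  (0 < p)%N ->
  sends_weak_normalization_into R A p N <->
  forall b, weak_mnm p b -> (b *+ p ^ N)%MM \in A.
Proof.
move=> p0; split=> [HN b [Gb [e Ab]]|HN v [[Gv _] [e [a Aa va]]]].
  suff: weak_normalization R A p (zvec b).
    by move=> /HN [a Aa]; rewrite -zvecMn => /zvec_inj ->.
  split; last by exists e, (b *+ p ^ e)%MM; rewrite ?zvecMn.
  (* A single cone term suffices: [b] is the inverse of [p ^ e] times [b *+ p ^ e]. *)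
  split=> //; exists 1%N, (fun=> (p ^ e)%:R^-1), (fun=> (b *+ p ^ e)%MM).
  split=> // [_|]; first by rewrite invr_ge0 ler0n.
  have q0 : (p ^ e)%:R != 0 :> R by rewrite pnatr_eq0 -lt0n expn_gt0 p0.
  rewrite big_ord1 zvecMn raddfMn /= -scaler_nat scalerA mulVf //.
  by rewrite scale1r.
have q0 : (0 < p ^ e)%N by rewrite expn_gt0 p0.
have [b vb] := zvec_of_mulrn q0 va; rewrite vb -zvecMn.
exists (b *+ p ^ N)%MM => //; apply: HN; split; first by rewrite -vb.
by exists e; rewrite (_ : _ *+ _ = a)%MM //; apply: zvec_inj; rewrite zvecMn -vb.
Qed.

(** The combinations of the generators form a submonoid containing them, so the minimality in
    [finitely_generated] applies. *)
Lemma asg_combination :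
  exists s : seq 'X_{1..n},
    (forall i : 'I_(size s), tnth (in_tuple s) i \in A) /\
    forall a, a \in A -> exists c : 'I_(size s) -> nat,
      a = (\sum_i tnth (in_tuple s) i *+ c i)%MM.
Proof.
have [s [As gens]] := asg_fg A; exists s; split=> [i|]; first exact/As/mem_tnth.
apply: gens => [|a /seq_tnthP[i ->]].
  split; first by exists (fun=> 0%N); rewrite big1 // => i _; rewrite mulm0n.
  move=> a b [c ->] [d ->]; exists (fun i => c i + d i)%N.
  by rewrite -big_split /=; apply: eq_bigr => i _; rewrite mulmnDr.
exists (fun j => (j == i) : nat); rewrite (bigD1 i) //= eqxx mulm1n.
rewrite big1 ?addm0 //.
by move=> j /negPf ->; rewrite mulm0n.
Qed.

(* Dividing the coefficients of [p ^ e v] with remainder by [p ^ e] reduces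
   [v], modulo [A], to an element of bounded degree. *)
Lemma weak_mnm_bounded (p : nat) : (0 < p)%N ->
  exists D, forall b, weak_mnm p b ->
    exists a w, [/\ a \in A, weak_mnm p w, (mdeg w < D)%N & b = (a + w)%MM].
Proof.
move=> p0; have [s [As gens]] := asg_combination.
set g := tnth (in_tuple s) in As gens.
(* The remainders [c i %% q] are below [q], so [w *+ q] has degree at most [q] times the sum of the
   degrees of the [g i]. *)
exists (\sum_i mdeg (g i)).+1 => b [Gb [e Ab]].
have [c bc] := gens _ Ab; set q := (p ^ e)%N in Ab bc.
have q0 : (0 < q)%N by rewrite expn_gt0 p0.
pose t := (\sum_i g i *+ (c i %/ q))%MM.
pose r := (\sum_i g i *+ (c i %% q))%MM.
have At : t \in A by apply: asg_sum => i; exact/asgMn/As.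
have Ar : r \in A by apply: asg_sum => i; exact/asgMn/As.
have btr : (b *+ q = t *+ q + r)%MM.
  apply/mnmP => j; rewrite bc mnmDE mulmnE !mnm_sumE big_distrl -big_split /=.
  by apply: eq_bigr => i _; rewrite !mulmnE -mulnA -mulnDr -divn_eq.
have tb : (t <= b)%MM by apply: (lepm_mul2r q0); rewrite btr lem_addr.
have wr : ((b - t) *+ q = r)%MM.
  apply/mnmP => j; rewrite mulmnE mnmBE mulnBl -!mulmnE btr mnmDE.
  by rewrite addKn.
exists t, (b - t)%MM; split=> //; last by rewrite addmC submK.
  split; last by exists e; rewrite wr.
  by rewrite zvecB //; apply: asg_groupB => //; exact: asg_groupP.
rewrite ltnS -(leq_pmul2r q0) -mdegMn wr mdeg_sum big_distrl /=.
by apply: leq_sum => i _; rewrite mdegMn leq_mul2l ltnW ?orbT // ltn_mod.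
Qed.

(** Only finitely many [w] have degree below [D], so the maximum of their exponents serves for
    all. *)
Lemma weak_mnm_exponent (p : nat) : (0 < p)%N ->
  exists N, forall b, weak_mnm p b -> (b *+ p ^ N)%MM \in A.
Proof.
move=> p0; have [D HD] := weak_mnm_bounded p0.
have [f Hf] : {f : 'X_{1..n < D} -> nat &
    forall w : 'X_{1..n < D}, weak_mnm p w -> (w *+ p ^ f w)%MM \in A}.
  pose Q (w : 'X_{1..n < D}) N := weak_mnm p w -> (w *+ p ^ N)%MM \in A.
  apply: (@choice _ _ Q) => w.
  have [[_ [e Ae]]|nw] := EM (weak_mnm p w); first by exists e.
  (* Arbitrary value outside the weak normalization. *)
  by exists 0%N.
exists (\max_w f w) => b /HD[a [w [Aa Ww wD ->]]].
have fw : (f (BMultinom wD) <= \max_w f w)%N by exact: leq_bigmax.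
rewrite mulmnDl; apply: asgD; first exact: asgMn.
rewrite -(subnKC fw) expnD -mulmnA; apply: asgMn.
exact: (Hf (BMultinom wD)).
Qed.

End Semigroup.

(** * Iterates of the Frobenius endomorphism *)

Section Frobenius.
Variables (R : comNzRingType) (p : nat) (pcharR : p \in [pchar R]%R) (e : nat).
Local Open Scope ring_scope.

(** The proof of the characteristic is an argument so that the morphism structures, which depend on
    it, can be attached. *)
Definition pFrobenius_iter of p \in [pchar R] := fun x : R => x ^+ (p ^ e).

Fact pFrobenius_iter_is_zmod_morphism : zmod_morphism (pFrobenius_iter pcharR).
Proof.
have pnat : [pchar R].-nat (p ^ e)%N.
  by rewrite pnatX pnatE ?pcharR // (pcharf_prime pcharR).
have FD (x y : R) : (x + y) ^+ (p ^ e) = x ^+ (p ^ e) + y ^+ (p ^ e).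
  exact: exprDn_pchar.
by move=> x y; apply/eqP; rewrite eq_sym subr_eq /pFrobenius_iter -FD subrK.
Qed.

Fact pFrobenius_iter_is_monoid_morphism :
  monoid_morphism (pFrobenius_iter pcharR).
Proof. by split=> [|x y]; rewrite /pFrobenius_iter ?expr1n ?exprMn. Qed.

HB.instance Definition _ := GRing.isZmodMorphism.Build R R
  (pFrobenius_iter pcharR) pFrobenius_iter_is_zmod_morphism.
HB.instance Definition _ := GRing.isMonoidMorphism.Build R R
  (pFrobenius_iter pcharR) pFrobenius_iter_is_monoid_morphism.

Lemma expr_sum_pchar (I : Type) (r : seq I) (P : pred I) (F : I -> R) :
  (\sum_(i <- r | P i) F i) ^+ (p ^ e) = \sum_(i <- r | P i) F i ^+ (p ^ e).
Proof. exact: (rmorph_sum (pFrobenius_iter pcharR)). Qed.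

End Frobenius.

(** * Generated ideals *)

Section IdealGen.
Variable R : comNzRingType.
Local Open Scope ring_scope.

Lemma ideal_gen_ideal (S : R -> Prop) : is_ideal (ideal_gen S).
Proof.
split=> [J [] //|x y Sx Sy J idJ SJ|a x Sx J idJ SJ]; case: (idJ) => J0 JD JM.
  by apply: JD; [exact: Sx | exact: Sy].
by apply: JM; exact: Sx.
Qed.

Lemma ideal_gen_sub (S : R -> Prop) x : S x -> ideal_gen S x.
Proof. by move=> Sx J _; exact. Qed.

Lemma ideal_sum (I : R -> Prop) (T : Type) (r : seq T) (F : T -> R) :
  is_ideal I -> (forall i, I (F i)) -> I (\sum_(i <- r) F i).
Proof. by case=> I0 ID _ IF; elim/big_rec: _ => // i x _; exact: ID. Qed.

End IdealGen.

(** * Powers of polynomials and extraction of roots *)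

Section FrobeniusPoly.
Variables (k : fieldType) (n p : nat) (pchark : p \in [pchar k]%R) (e : nat).
Local Notation q := (p ^ e)%N.
Local Open Scope ring_scope.

Let q_gt0 : (0 < q)%N.
Proof. by rewrite expn_gt0 prime_gt0 // (pcharf_prime pchark). Qed.

Lemma mpoly_frobE (f : {mpoly k[n]}) :
  f ^+ q = \sum_(m <- msupp f) f@_m ^+ q *: 'X_[m *+ q].
Proof.
have pcharP : p \in [pchar {mpoly k[n]}] by rewrite pchar_lalg.
rewrite {1}[f]mpolyE (expr_sum_pchar pcharP); apply: eq_bigr => m _.
by rewrite exprZn mpolyXn.
Qed.

(** Multiplication by [q] is injective on exponents, so the terms of [f ^+ q] do not collide. *)
Lemma mcoeff_frob (f : {mpoly k[n]}) m : (f ^+ q)@_(m *+ q) = f@_m ^+ q.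
Proof.
rewrite mpoly_frobE raddf_sum /=.
under eq_bigr => c _ do rewrite mcoeffZ mcoeffX (inj_eq (mulmn_inj q_gt0)).
case: (boolP (m \in msupp f)) => [mf|mf].
  rewrite (bigD1_seq m) ?msupp_uniq //= eqxx mulr1 big1 ?addr0 // => c /negPf ->.
  by rewrite mulr0.
rewrite big_seq big1 => [|c cf]; last first.
  by case: eqP cf mf => [-> ->|] //; rewrite mulr0.
by rewrite (memN_msupp_eq0 mf) expr0n gtn_eqF.
Qed.

(* The coefficient equations form a linear system over [k ^ q] that is solvable
   over [k], hence over [k ^ q]. *)
Lemma frob_descent r (c : 'I_r -> k) (h : 'I_r -> {mpoly k[n]}) f :
  f ^+ q = \sum_i c i *: h i ^+ q ->
  exists d : 'I_r -> k, f = \sum_i d i *: h i.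
Proof.
(* All exponents that occur, so that finitely many coefficient equations suffice. *)
move=> fE; pose s := msupp f ++ flatten [seq msupp (h i) | i <- enum 'I_r].
pose b : 'rV[k]_(size s) := \row_j f@_(tnth (in_tuple s) j).
pose M : 'M[k]_(r, size s) := \matrix_(i, j) (h i)@_(tnth (in_tuple s) j).
pose F := pFrobenius_iter e pchark.
have: (map_mx F b <= map_mx F M)%MS.
  apply/submxP; exists (\row_i c i); apply/rowP => j; rewrite !mxE.
  rewrite /F /pFrobenius_iter -mcoeff_frob fE raddf_sum /=.
  by apply: eq_bigr => i _; rewrite mcoeffZ mcoeff_frob !mxE.
(* Solvability of a linear system is unchanged under the field morphism [F]. *)
rewrite map_submx => /submxP[d bd]; exists (d 0); apply/mpolyP => m.
rewrite raddf_sum /=; under eq_bigr do rewrite mcoeffZ.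
have [/seq_tnthP[j ->]|ms] := boolP (m \in s).
  move/rowP: bd => /(_ j); rewrite !mxE => ->.
  by apply: eq_bigr => i _; rewrite mxE.
move: ms; rewrite mem_cat negb_or => /andP[/memN_msupp_eq0 -> ms].
rewrite big1 // => i _; rewrite memN_msupp_eq0 ?mulr0 //.
apply: contra ms => mi; apply/flattenP; exists (msupp (h i)) => //.
by apply/map_f/mem_enum.
Qed.

End FrobeniusPoly.

(** * Projection onto a set of monomials *)

Section Restriction.
Variables (k : fieldType) (n : nat) (P : 'X_{1..n} -> Prop).
Local Open Scope ring_scope.

Definition mrestr (f : {mpoly k[n]}) : {mpoly k[n]} :=
  \sum_(m <- msupp f | `[< P m >]) f@_m *: 'X_[m].

Lemma mcoeff_mrestr f m : (mrestr f)@_m = if `[< P m >] then f@_m else 0.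
Proof.
rewrite raddf_sum /=; under eq_bigr do rewrite mcoeffZ mcoeffX.
case: asboolP => Pm; last first.
  rewrite big1 // => c /asboolP Pc; case: eqP => [cm|]; last by rewrite mulr0.
  by case: Pm; rewrite -cm.
have [mf|mf] := boolP (m \in msupp f).
  rewrite big_mkcond (bigD1_seq m) ?msupp_uniq //= asboolT // eqxx mulr1.
  by rewrite big1 ?addr0 // => c /negPf ->; rewrite mulr0 if_same.
rewrite memN_msupp_eq0 // big_seq_cond big1 // => c /andP[cf _].
by case: eqP cf mf => [-> ->|] //; rewrite mulr0.
Qed.

Fact mrestr_is_linear : linear mrestr.
Proof.
move=> a f g; apply/mpolyP => m; rewrite mcoeffD mcoeffZ !mcoeff_mrestr.
by rewrite mcoeffD mcoeffZ; case: ifP => //; rewrite mulr0 addr0.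
Qed.

HB.instance Definition _ :=
  GRing.isLinear.Build k {mpoly k[n]} {mpoly k[n]} _ mrestr mrestr_is_linear.

Lemma mrestrX m : mrestr 'X_[m] = if `[< P m >] then 'X_[m] else 0.
Proof.
apply/mpolyP => c; rewrite mcoeff_mrestr (fun_if (mcoeff c)) mcoeff0 mcoeffX.
by case: eqP => [->|] //=; do !case: ifP.
Qed.

End Restriction.

(** * Frobenius powers of ideals of the semigroup ring *)

Section SemigroupFrobenius.
Variables (k : fieldType) (n : nat) (A : affine_semigroup n).
Variables (p : nat) (pchark : p \in [pchar k]%R) (e : nat).
Local Notation q := (p ^ e)%N.
Local Open Scope ring_scope.

Let q_gt0 : (0 < q)%N.
Proof. by rewrite expn_gt0 prime_gt0 // (pcharf_prime pchark). Qed.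

(** The non-negative part of the lattice $qG(A)$. *)
Definition frob_lattice (m : 'X_{1..n}) : Prop :=
  exists2 b, m = (b *+ q)%MM & asg_group A (zvec b).

Lemma frob_latticeD m c : c \in A ->
  frob_lattice (m + c *+ q)%MM <-> frob_lattice m.
Proof.
move=> Ac; split=> -[b mb Gb].
  (* This makes the subtraction [b - c] exact rather than truncated. *)
  have cb : (c <= b)%MM by apply: (lepm_mul2r q_gt0); rewrite -mb lem_addl.
  exists (b - c)%MM; last first.
    by rewrite zvecB //; exact: asg_groupB Gb (asg_groupP Ac).
  apply/mnmP => i; move/mnmP/(_ i): mb.
  by rewrite !(mulmnE, mnmBE, mnmDE) mulnBl => <-; rewrite addnK.
exists (b + c)%MM; first by rewrite mb mulmnDl.
by rewrite zvecD; exact: asg_groupD Gb (asg_groupP Ac).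
Qed.

Lemma asg_supp (x : asg_ring k A) m : m \in msupp (val x) -> m \in A.
Proof. exact: (allP (asg_valP x)). Qed.

(** The exponents of [val x ^+ q] are of the form [c *+ q] with [c] in [A]; shifting by them
    preserves [frob_lattice] and its complement. *)
Lemma mrestr_frob (f : {mpoly k[n]}) (x : asg_ring k A) :
  mrestr frob_lattice (f * val x ^+ q) = mrestr frob_lattice f * val x ^+ q.
Proof.
rewrite [f]mpolyE mulr_suml !linear_sum mulr_suml; apply: eq_bigr => m _.
rewrite -scalerAl !linearZ -scalerAl; congr (_ *: _).
rewrite (mpoly_frobE pchark) !mulr_sumr linear_sum big_seq [RHS]big_seq.
apply: eq_bigr => c /asg_supp Ac; rewrite -!scalerAr linearZ; congr (_ *: _).
rewrite -mpolyXD /= !mrestrX (asbool_equiv_eq (frob_latticeD m Ac)).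
by case: ifP => _; rewrite ?mul0r // mpolyXD.
Qed.

Lemma mrestr_frob1 (x : asg_ring k A) :
  mrestr frob_lattice (val x ^+ q) = val x ^+ q.
Proof.
rewrite -[X in mrestr _ X]mul1r mrestr_frob -mpolyX0 mrestrX.
rewrite asboolT ?mpolyX0 ?mul1r //.
by exists 0%MM; [apply/mnmP => i; rewrite mulmnE !mnmE | rewrite zvec0 => H].
Qed.

(* These products span the extension of [I] to the semigroup ring of the [p]-weak
   normalization. *)
Definition weak_mult (I : asg_ring k A -> Prop) (h : {mpoly k[n]}) : Prop :=
  exists b x, [/\ weak_mnm A p b, I x & h = 'X_[b] * val x].

Definition frob_span (I : asg_ring k A -> Prop) (f : {mpoly k[n]}) : Prop :=
  exists s : seq (k * {mpoly k[n]}),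
    (forall u, u \in s -> weak_mult I u.2) /\ f = \sum_(u <- s) u.1 *: u.2 ^+ q.

Lemma frob_power_mrestr (I : asg_ring k A -> Prop) y :
  frob_power p e I y -> frob_span I (mrestr frob_lattice (val y)).
Proof.
have span0 : frob_span I 0 by exists [::]; rewrite big_nil.
have spanD f g : frob_span I f -> frob_span I g -> frob_span I (f + g).
  move=> [s [Is ->]] [t [It ->]]; exists (s ++ t); rewrite big_cat; split=> // u.
  by rewrite mem_cat => /orP[/Is|/It].
(* Quantifying over all multiples makes [J] an ideal, which leaves only the generators to check. *)
pose J y := forall a : asg_ring k A,
  frob_span I (mrestr frob_lattice (val (a * y))).
suff IJ z : frob_power p e I z -> J z.
  by move=> /IJ /(_ 1); rewrite mul1r.
apply; first split=> [a|u v Ju Jv a|a u Ju c].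
- by rewrite mulr0 rmorph0 linear0.
- by rewrite mulrDr rmorphD linearD; apply: spanD; [exact: Ju | exact: Jv].
- by rewrite mulrA; exact: Ju.
(* A surviving exponent of [a] is [b *+ q], in [A], so [b] is in the weak normalization and the term
   times [x ^+ q] is a scalar times the [q]-th power of ['X_[b] * val x]. *)
move=> _ [x Ix ->] a; rewrite rmorphM rmorphXn mrestr_frob mulr_suml big_seq_cond.
elim/big_rec: _ => // m f /andP[/asg_supp Am /asboolP[b mb Gb]] spf.
apply: spanD => //; exists [:: ((val a)@_m, 'X_[b] * val x)]; split.
  move=> u; rewrite inE => /eqP -> /=; exists b, x; split=> //.
  by split=> //; exists e; rewrite -mb.
by rewrite big_seq1 /= exprMn mpolyXn -mb scalerAl.
Qed.

(** The power [val x ^+ q] is its own projection, hence lies in [frob_span]; descent then removes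
    the [q]-th powers. *)
Lemma frob_closure_spanned (I : asg_ring k A -> Prop) x :
  frob_power p e I (x ^+ q) ->
  exists r (d : 'I_r -> k) (h : 'I_r -> {mpoly k[n]}),
    (forall i, weak_mult I (h i)) /\ val x = \sum_i d i *: h i.
Proof.
move=> /frob_power_mrestr[s [Is]]; rewrite rmorphXn mrestr_frob1 big_tnth.
move=> /(frob_descent pchark)[d xE]; exists (size s), d.
exists (fun i => (tnth (in_tuple s) i).2); split=> // i.
exact/Is/mem_tnth.
Qed.

End SemigroupFrobenius.

(** Raising ['X_[b]] to the power [p ^ N] brings it into [k[A]], where it is a legitimate
    coefficient of [x ^+ (p ^ N)]. *)
Lemma weak_mult_frob (k : fieldType) (n : nat) (A : affine_semigroup n)
    (p N : nat) (I : asg_ring k A -> Prop) (h : {mpoly k[n]}) (c : k) :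
  (forall b, weak_mnm A p b -> (b *+ p ^ N)%MM \in A) -> weak_mult p I h ->
  exists y, frob_power p N I y /\ val y = (c *: h ^+ (p ^ N))%R.
Proof.
move=> AN [b [x [/AN Ab Ix ->]]].
have Xb : ('X_[b *+ p ^ N] : {mpoly k[n]})%R \in asg_poly_pred A.
  by apply/allP => m; rewrite msuppX inE => /eqP ->.
exists (c *: AsgRing Xb * x ^+ (p ^ N))%R; split.
  have [_ _ idM] : is_ideal (frob_power p N I) by exact: ideal_gen_ideal.
  by apply: idM; apply: ideal_gen_sub; exists x.
by rewrite rmorphM rmorphXn /= exprMn mpolyXn scalerAl.
Qed.

Theorem theorem3 (R : realType) (n : nat) (A : affine_semigroup n)
  (k : fieldType) (p : nat) (pchark : p \in [pchar k]%R) :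
  (exists N0 : nat, is_least (sends_weak_normalization_into R A p) N0) /\
  forall N0 : nat, is_least (sends_weak_normalization_into R A p) N0 ->
  forall I : asg_ring k A -> Prop, is_ideal I ->
    exists e : nat, is_Fte p I e /\ (e <= N0)%N.
Proof.
have p0 : (0 < p)%N by rewrite prime_gt0 // (pcharf_prime pchark).
split.
  have [N HN] := weak_mnm_exponent A p0.
  have [|e [He _]] := @exists_least (sends_weak_normalization_into R A p) N.
    exact/(sends_weak_normalization_intoP _ _ _ p0).
  by exists e.
move=> N0 [/(sends_weak_normalization_intoP _ _ _ p0) HN0 _] I _.
(* It suffices that [N0] itself satisfies the equality; the [e] below may vary with [y]. *)
apply: exists_least => x; split=> [|Ix J idJ IJ].
  apply=> [|_ [y [e Iy] ->]]; first exact: ideal_gen_ideal.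
  have [r [d [h [Ih yE]]]] := frob_closure_spanned pchark Iy.
  have [z Hz] : {z : 'I_r -> asg_ring k A & forall i, frob_power p N0 I (z i) /\
      val (z i) = (d i ^+ (p ^ N0) *: h i ^+ (p ^ N0))%R}.
    exact: (choice (fun i => weak_mult_frob (d i ^+ (p ^ N0))%R HN0 (Ih i))).
  suff -> : (y ^+ (p ^ N0) = \sum_i z i)%R.
    apply: (@ideal_sum _ (frob_power p N0 I)) => [|i]; last by case: (Hz i).
    exact: ideal_gen_ideal.
  apply: val_inj; rewrite rmorphXn rmorph_sum /= -[asg_val y]/(val y) yE.
  have pcharP : p \in [pchar {mpoly k[n]}]%R by rewrite pchar_lalg.
  rewrite (expr_sum_pchar pcharP); apply: eq_bigr => i _.
  by case: (Hz i) => _ /= ->; rewrite exprZn.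
(* The ideal lies in its Frobenius closure, with exponent [0]. *)
apply: Ix => // _ [y Iy ->]; apply: IJ; exists y => //.
by exists 0%N; apply: ideal_gen_sub; exists y.
Qed.
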